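(* Let $G$ be a metrizable locally compact Abelian group. If $T\subseteq G$ is a $B(G)$-interpolation set (i.e., a topological Sidon set), then there is a neighbourhood $U$ of the identity such that $T$ is right $U$-uniformly discrete and $UT$ is translation-compact. In particular, Sidon subsets (i.e., $B(G)$-interpolation sets) of discrete Abelian groups $G$ are translation-finite.
   Context: $B(G)$ is the Fourier–Stieltjes algebra of $G$: the linear span of the continuous positive definite functions on $G$. $T\subseteq G$ is a $B(G)$-interpolation set if every bounded $f:T\to\mathbb C$ extends to a function in $B(G)$. $T$ is right $U$-uniformly discrete if $Us\cap Us'=\emptyset$ for all $s\ne s'$ in $T$. A set $S\subseteq G$ is right translation-compact if every non-relatively compact $L\subseteq G$ contains a finite subset $F$ such that $\bigcap_{b\in F}b^{-1}S$ is relatively compact; left translation-compact if the same holds with $\bigcap_{b\in F}Sb^{-1}$; translation-compact if both. $S$ is right (left) translation-finite if every infinite $L\subseteq G$ contains a finite subset $F$ such that $\bigcap_{b\in F}b^{-1}S$ (respectively, $\bigcap_{b\in F}Sb^{-1}$) is finite; translation-finite if both. *)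

(* Defs.v *)
From HB Require Import structures.
From mathcomp Require Import all_boot all_order all_algebra.
From mathcomp Require Import all_classical all_reals all_analysis.
From mathcomp Require Import complex.

Set Implicit Arguments.
Unset Strict Implicit.
Unset Printing Implicit Defensive.

Import Order.TTheory GRing.Theory Num.Theory.
Import numFieldNormedType.Exports.

Local Open Scope classical_set_scope.
Local Open Scope ring_scope.

(* Groups are Abelian and written additively: the identity is 0 and b^-1 s is
   - b + s. [R[i]^o] is the field of complex numbers with its usual topology. *)

Definition metrizable (R : realType) (X : topologicalType) : Prop :=
  exists d : X -> X -> R,
    [/\ forall x y, d x y = 0 <-> x = y,
        forall x y, d x y = d y x,
        forall x y z, d x z <= d x y + d y z &
        forall x, nbhs x = nbhs_ball_ (fun y e => [set z | d y z < e]) x].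

Definition discrete_top (X : topologicalType) : Prop :=
  @nbhs X X = principal_filter.

(* The order of [R[i]] is partial: [0 <= z] says that z is real and
   nonnegative. *)
Definition positive_definite (R : realType) (G : zmodType)
    (phi : G -> R[i]^o) : Prop :=
  forall (n : nat) (x : 'I_n -> G) (c : 'I_n -> R[i]),
    0 <= \sum_(j < n) \sum_(k < n) c j * (c k)^*%C * phi (- x k + x j).

Definition fourier_stieltjes (R : realType) (G : topologicalZmodType) :
    set (G -> R[i]^o) :=
  [set f : G -> R[i]^o |
     exists (n : nat) (a : 'I_n -> R[i]) (phi : 'I_n -> G -> R[i]^o),
       (forall i, continuous (phi i) /\ positive_definite (phi i)) /\
       forall x, f x = \sum_(i < n) a i * phi i x].

(* A function on T is represented by a function on G whose values outside T
   are irrelevant. *)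
Definition BG_interpolation (R : realType) (G : topologicalZmodType)
    (T : set G) : Prop :=
  forall f : G -> R[i]^o, [bounded f t | t in T] ->
    exists2 g : G -> R[i]^o, fourier_stieltjes g & forall t, T t -> g t = f t.

Section Translates.
Context {G : topologicalZmodType}.
Implicit Types (S T U : set G).

Definition right_uniformly_discrete U T : Prop :=
  forall s s', T s -> T s' -> s <> s' ->
    [set u + s | u in U] `&` [set u + s' | u in U] = set0.

Definition right_translation_compact S : Prop :=
  forall L : set G, ~ precompact L ->
    exists F : set G, [/\ F `<=` L, finite_set F &
      precompact (\bigcap_(b in F) [set - b + s | s in S])].

Definition left_translation_compact S : Prop :=
  forall L : set G, ~ precompact L ->
    exists F : set G, [/\ F `<=` L, finite_set F &
      precompact (\bigcap_(b in F) [set s - b | s in S])].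

Definition translation_compact S : Prop :=
  right_translation_compact S /\ left_translation_compact S.

Definition right_translation_finite S : Prop :=
  forall L : set G, infinite_set L ->
    exists F : set G, [/\ F `<=` L, finite_set F &
      finite_set (\bigcap_(b in F) [set - b + s | s in S])].

Definition left_translation_finite S : Prop :=
  forall L : set G, infinite_set L ->
    exists F : set G, [/\ F `<=` L, finite_set F &
      finite_set (\bigcap_(b in F) [set s - b | s in S])].

Definition translation_finite S : Prop :=
  right_translation_finite S /\ left_translation_finite S.

End Translates.

(* Main.v *)
(* For g in B(G), the matrices (g (b_i + t_j)) are Schur multipliers of bounded
   norm, so |sum_ij h_ij g (b_i + t_j)| = O(N^(3/2)) for every N x N sign matrix
   h with orthogonal columns, whereas the sum would have order N^2 if
   g (b_i + t_j) were close to h_ij.  If U + T is never translation-compact,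
   then for each U of a countable base at 0 and each N there are b_i, t_j such that
   the b_i + t_j lie U-close to N^2 distinct points of T.  A sign function on T
   that follows h on such a square for each U in the base, with N unbounded,
   has no uniformly continuous extension g satisfying the O(N^(3/2)) bound.
   Uniform discreteness is the same argument with pairs in place of squares. *)

Require Import Defs.
From mathcomp Require Import all_boot all_order all_algebra.
From mathcomp Require Import all_classical all_reals all_analysis.
From mathcomp Require Import complex ring.

Set Implicit Arguments.
Unset Strict Implicit.
Unset Printing Implicit Defensive.
Import Order.TTheory GRing.Theory Num.Theory.
Import numFieldNormedType.Exports.
Local Open Scope classical_set_scope.
Local Open Scope ring_scope.

(** * Positive definite functions: symmetry, uniform continuity, a bound against orthogonal
    matrices *)

Section PositiveDefinite.
Context {C : numClosedFieldType} {G : zmodType}.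
Variable phi : G -> C.
Hypothesis phi_pd : forall (n : nat) (x : 'I_n -> G) (c : 'I_n -> C),
  0 <= \sum_(j < n) \sum_(k < n) c j * (c k)^* * phi (- x k + x j).

(** Transport along [enum_val]; the Gram matrices below are indexed by types such as [unit + I]. *)
Lemma pd_sum_ge0 (I : finType) (x : I -> G) (c : I -> C) :
  0 <= \sum_j \sum_k c j * (c k)^* * phi (x j - x k).
Proof.
have bijI := onW_bij predT (enum_val_bij I).
rewrite (reindex _ bijI) /=.
under eq_bigr do [rewrite (reindex _ bijI) /=; under eq_bigr do rewrite addrC].
exact: phi_pd (x \o enum_val) (c \o enum_val).
Qed.

Lemma pd_ge0 : 0 <= phi 0.
Proof.
have := pd_sum_ge0 (fun=> 0) (fun _ : 'I_1 => 1).
by rewrite !big_ord1 conjC1 !mul1r subr0.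
Qed.

Lemma pd_opp (x : G) : phi (- x) = (phi x)^*.
Proof.
(* [Q b] is the quadratic form at the points 0, [x] with coefficients 1, [b]. That it is real for
   [b] equal to 1 and to ['i] determines [phi (- x)]. *)
pose Q b := phi 0 + b^* * phi (- x) + (b * phi x + b * b^* * phi 0).
have QE b : (Q b)^* = Q b.
  apply/CrealP/ger0_real.
  have := pd_sum_ge0 (fun i : 'I_2 => nth 0 [:: 0; x] i)
                     (fun i : 'I_2 => nth 0 [:: 1; b] i).
  by rewrite !big_ord_recl !big_ord0 /= !addr0 !conjC1 !mul1r !mulr1 !subr0
     !sub0r subrr.
have := QE 'i; have := QE 1.
rewrite /Q !rmorphD !rmorphM /= !conjCK !conjC1 !mul1r conjCi.
rewrite (CrealP (ger0_real pd_ge0)).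
set p := phi x; set q := phi (- x) => E1 E2.
have : 'i * (2 * (q - p^*)) = 0 :> C.
  transitivity ('i * (phi 0 + q + (p + phi 0) - (phi 0 + q^* + (p^* + phi 0))) +
    (phi 0 + 'i * q^* + (- 'i * p^* + - 'i * 'i * phi 0) -
    (phi 0 - 'i * q + ('i * p + 'i * - 'i * phi 0)))); first by ring.
  by rewrite -E1 E2; ring.
move/eqP; rewrite !mulf_eq0 (negbTE (neq0Ci C)) pnatr_eq0 /= subr_eq0.
by move/eqP.
Qed.

(** The form is tested at 0, [x], [y] with coefficients [- D], [r], [- r]. Taking [r = phi 0 + 1]
    rather than [phi 0] makes it positive, so that it can be cancelled. *)
Lemma pd_unif (x y : G) :
  `|phi x - phi y| ^+ 2 <=
  (phi 0 + 1) * (2 * phi 0 - phi (x - y) - phi (y - x)).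
Proof.
set r := phi 0 + 1; set d := (X in _ * X); set D := phi x - phi y.
have r_gt0 : 0 < r by rewrite ltr_wpDl ?pd_ge0.
have r_real : r^* = r by apply/CrealP/ger0_real/ltW.
rewrite -(ler_pM2l r_gt0) normCK -subr_ge0.
have N_ge0 : 0 <= D * D^* by rewrite -normCK exprn_ge0.
apply: le_trans (_ : 0 <= r * (r * d) - r * (D * D^*) - D * D^*) _; last first.
  by rewrite lerBlDr lerDl.
have := pd_sum_ge0 (fun i : 'I_3 => nth 0 [:: 0; x; y] i)
                   (fun i : 'I_3 => nth 0 [:: - D; r; - r] i).
rewrite !big_ord_recl !big_ord0 /= !subr0 !sub0r !subrr !rmorphN /= r_real.
rewrite !pd_opp; congr (0 <= _).
by rewrite /D /d /r rmorphB /=; ring.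
Qed.

(* The 2N x 2N Gram matrix of the points b_i, - t_j is tested on the N vectors
   w s e_i - sum_j h_ij e_j, where w is a phase and s = sqrt N. *)
Lemma pd_orthogonal_bound (I : finType) (s : C) (h : I -> I -> C)
    (b t : I -> G) :
  0 < s -> s ^+ 2 = #|I|%:R -> (forall i j, (h i j)^* = h i j) ->
  (forall j k, \sum_i h i j * h i k = (j == k)%:R * s ^+ 2) ->
  `|\sum_i \sum_j h i j * phi (b i + t j)| <= s ^+ 3 * phi 0.
Proof.
move=> s_gt0 sE h_real h_orth; set S := \sum_i _.
have s_real : s^* = s by apply/CrealP/ger0_real/ltW.
(* The phase [w] rotates [S] onto the nonnegative axis; if [S] is 0, then 1 will do. *)
have [w w_norm wS] : exists2 w : C, w * w^* = 1 & w * S = `|S|.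
  have [->|S0] := eqVneq S 0; last first.
    exists (`|S| / S); last by rewrite divfK.
    by rewrite -normCK normrM normfV normr_id divff ?expr1n ?normr_eq0.
  by exists 1; rewrite ?conjC1 ?mulr1 ?mulr0 ?normr0.
have wSc : w^* * S^* = `|S|.
  by rewrite -rmorphM /= wS; apply/CrealP/normr_real.
have Q i : 0 <= s ^+ 2 * phi 0
    + \sum_j \sum_k h i j * h i k * phi (t k - t j)
    - s * (w * \sum_j h i j * phi (b i + t j))
    - s * (w^* * \sum_j h i j * (phi (b i + t j))^*).
  pose x (o : unit + I) := if o is inr j then - t j else b i.
  pose c (o : unit + I) := if o is inr j then - h i j else s * w.
  suff -> : s ^+ 2 * phi 0 + \sum_j \sum_k h i j * h i k * phi (t k - t j)
      - s * (w * \sum_j h i j * phi (b i + t j))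
      - s * (w^* * \sum_j h i j * (phi (b i + t j))^*) =
      \sum_j \sum_k c j * (c k)^* * phi (x j - x k) by exact: pd_sum_ge0.
  apply/esym; rewrite big_sumType /= big_const card_unit /= addr0.
  rewrite big_sumType /= big_const card_unit /= addr0.
  under [X in _ + _ + X = _]eq_bigr do
    rewrite big_sumType /= big_const card_unit /= addr0.
  rewrite big_split /= subrr.
  have -> : s * w * (s * w)^* * phi 0 = s ^+ 2 * phi 0.
    rewrite rmorphM /= s_real.
    transitivity (s ^+ 2 * (w * w^*) * phi 0); first by ring.
    by rewrite w_norm mulr1.
  have -> : \sum_j s * w * (- h i j)^* * phi (b i - - t j) =
      - (s * (w * \sum_j h i j * phi (b i + t j))).
    rewrite !mulr_sumr -sumrN; apply: eq_bigr => j _.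
    by rewrite rmorphN /= h_real opprK; ring.
  have -> : \sum_j - h i j * (s * w)^* * phi (- t j - b i) =
      - (s * (w^* * \sum_j h i j * (phi (b i + t j))^*)).
    rewrite !mulr_sumr -sumrN; apply: eq_bigr => j _.
    by rewrite -opprD pd_opp [t j + _]addrC rmorphM /= s_real; ring.
  have -> : \sum_j \sum_k - h i j * (- h i k)^* * phi (- t j - - t k) =
      \sum_j \sum_k h i j * h i k * phi (t k - t j).
    apply: eq_bigr => j _; apply: eq_bigr => k _.
    by rewrite rmorphN /= h_real opprK mulrNN [- t j + _]addrC.
  by ring.
(* After summation over [i], orthogonality of the columns removes the terms with [j != k], and there
   remains [2 s^4 phi 0 - 2 s |S| >= 0]. *)
have : 0 <= \sum_i (s ^+ 2 * phi 0
    + \sum_j \sum_k h i j * h i k * phi (t k - t j)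
    - s * (w * \sum_j h i j * phi (b i + t j))
    - s * (w^* * \sum_j h i j * (phi (b i + t j))^*)).
  exact: sumr_ge0.
rewrite !sumrB big_split /= -!mulr_sumr wS.
have -> : \sum_i \sum_j h i j * (phi (b i + t j))^* = S^*.
  rewrite rmorph_sum /=; apply: eq_bigr => i _.
  by rewrite rmorph_sum /=; apply: eq_bigr => j _; rewrite rmorphM /= h_real.
have -> : \sum_i \sum_j \sum_k h i j * h i k * phi (t k - t j) =
    s ^+ 4 * phi 0.
  rewrite exchange_big /=.
  transitivity (\sum_(j : I) s ^+ 2 * phi 0).
    apply: eq_bigr => j _.
    rewrite exchange_big (bigD1 j) //= [X in _ + X]big1 ?addr0.
      by rewrite -mulr_suml h_orth eqxx mul1r subrr.
    by move=> k kj; rewrite -mulr_suml h_orth eq_sym (negbTE kj) !mul0r.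
  by rewrite sumr_const cardT -cardE -[LHS]mulr_natr -sE; ring.
rewrite wSc sumr_const cardT -cardE -[(_ *+ _)]mulr_natr -sE => H.
rewrite -(ler_pM2l s_gt0) -(ler_pM2l (ltr0n _ 2)) -subr_ge0.
by apply: le_trans H _; rewrite le_eqVlt; apply/orP; left; apply/eqP; ring.
Qed.
End PositiveDefinite.

(** * Sign matrices with orthogonal columns *)

(** The dot product over the field with two elements: the signs [(-1) ^+ walsh a b] form the
    Sylvester-Hadamard matrix of order [2 ^ n]. *)
Definition walsh (n : nat) (a b : {ffun 'I_n -> bool}) : bool :=
  \big[addb/false]_i (a i && b i).

(** The sum over [a] factors over the coordinates, and a coordinate where [b] and [c] differ
    contributes the factor 1 - 1. *)
Lemma walsh_orthogonal (C : numDomainType) (n : nat)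
    (b c : {ffun 'I_n -> bool}) :
  \sum_a (-1) ^+ walsh a b * (-1) ^+ walsh a c = (b == c)%:R * 2 ^+ n :> C.
Proof.
have walshE (a d : {ffun 'I_n -> bool}) :
    (-1) ^+ walsh a d = \prod_i (-1) ^+ (a i && d i) :> C.
  by rewrite (big_morph (fun x : bool => (-1) ^+ x) (@signr_addb C) (erefl _)).
pose F i (x : bool) : C := (-1) ^+ (x && b i) * (-1) ^+ (x && c i).
transitivity (\prod_i \sum_x F i x).
  rewrite bigA_distr_bigA; apply: eq_bigr => a _.
  by rewrite !walshE -big_split.
have FE i : \sum_x F i x = (b i == c i)%:R * 2.
  rewrite big_bool /F /= mulr1 -signr_addb.
  by case: (b i) (c i) => -[] /=; rewrite ?expr0 ?expr1 ?mul1r ?mul0r ?addNr.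
under eq_bigr do rewrite FE.
rewrite big_split /= prodr_const cardT -cardE card_ord; congr (_ * _).
have [->|/eqP bc] := eqVneq b c; first by rewrite big1// => i _; rewrite eqxx.
have [i bci] : exists i, b i != c i.
  apply/existsP; apply: contra_notT bc => /existsPn H.
  by apply/ffunP => i; apply/eqP/negPn.
by rewrite (bigD1 i) //= (negbTE bci) mul0r.
Qed.

(** * Uniform continuity and the matrix bound on B(G) *)

Section FourierStieltjes.
Context {R : realType} {G : topologicalZmodType}.
Implicit Types g phi : G -> R[i]^o.

(** By [pd_unif], increments of [phi] are controlled by its values near 0, so continuity at 0
    suffices. *)
Lemma positive_definite_unif phi (e : R[i]) :
  positive_definite phi -> continuous phi -> 0 < e ->
  \forall z \near (0 : G), forall x y, x - y = z -> `|phi x - phi y| <= e.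
Proof.
move=> pd_phi phi_cont e_gt0.
have r_gt0 : 0 < phi 0 + 1 by rewrite ltr_wpDl // (pd_ge0 pd_phi).
pose d : R[i] := e ^+ 2 / (2 * (phi 0 + 1)).
have d_gt0 : 0 < d by rewrite divr_gt0 ?exprn_gt0 ?mulr_gt0.
have near_d : \forall z \near (0 : G), `|phi 0 - phi z| < d.
  exact: (@cvgr_dist_lt _ R[i]^o _ _ _ phi _ (phi_cont 0) d d_gt0).
have near_dN : \forall z \near (0 : G), `|phi 0 - phi (- z)| < d.
  have oc : - z @[z --> (0 : G)] --> (0 : G).
    by rewrite -[X in _ --> X]oppr0; exact: opp_continuous.
  exact: (oc _ near_d).
near=> z => x y xyz.
rewrite -(@ler_pXn2r _ 2%N) ?nnegrE// ?(ltW e_gt0)//.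
have H := pd_unif pd_phi x y.
apply: (le_trans H).
(* The right-hand side dominates a square, hence is nonnegative and equal to its norm; this opens
   the way to the triangle inequality although the order is partial. *)
rewrite -(ger0_norm (le_trans (exprn_ge0 _ (normr_ge0 _)) H)).
rewrite normrM (gtr0_norm r_gt0).
have -> : e ^+ 2 = (phi 0 + 1) * (d + d).
  by rewrite /d; field; rewrite gt_eqF.
rewrite ler_pM2l //.
have -> : 2 * phi 0 - phi (x - y) - phi (y - x) =
  (phi 0 - phi z) + (phi 0 - phi (- z)) by rewrite -xyz opprB; ring.
apply: (le_trans (ler_normD _ _)).
by apply: lerD; apply: ltW; [near: z | near: z].
Unshelve. all: by end_near.
Qed.

Lemma fourier_stieltjes_unif g (e : R[i]) :
  fourier_stieltjes g -> 0 < e ->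
  \forall z \near (0 : G), forall x y, x - y = z -> `|g x - g y| <= e.
Proof.
move=> [n [a [phi [phiP gE]]]] e_gt0.
(* The summand 1 allows division by [M] even if all coefficients vanish. *)
pose M := \sum_i `|a i| + 1.
have M_gt0 : 0 < M by rewrite ltr_wpDl ?sumr_ge0.
have : \forall z \near (0 : G), forall i,
    forall x y, x - y = z -> `|phi i x - phi i y| <= e / M.
  apply: filter_forall => i; have [] := phiP i => c p.
  by apply: positive_definite_unif; rewrite ?divr_gt0.
apply: filterS => z Hz x y xyz; rewrite !gE -sumrB.
apply: le_trans (ler_norm_sum _ _ _) _.
apply: le_trans (_ : \sum_i `|a i| * (e / M) <= _).
  by apply: ler_sum => i _; rewrite -mulrBr normrM ler_wpM2l ?Hz.
rewrite -mulr_suml mulrA ler_pdivrMr // mulrC ler_pM2l // lerDl //.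
Qed.

(** [M] depends on [g] alone, not on the size of the matrix; it is a natural number so that some
    power of 2 visibly exceeds it. *)
Lemma fourier_stieltjes_orthogonal_bound g : fourier_stieltjes g ->
  exists M : nat, forall (I : finType) (s : R[i]) (h : I -> I -> bool)
    (b t : I -> G),
  0 < s -> s ^+ 2 = #|I|%:R ->
  (forall j k, \sum_i (-1) ^+ h i j * (-1) ^+ h i k = (j == k)%:R * s ^+ 2) ->
  `|\sum_i \sum_j (-1) ^+ h i j * g (b i + t j)| <= s ^+ 3 * M%:R.
Proof.
move=> [n [a [phi [phiP gE]]]].
pose M := \sum_i `|a i| * phi i 0.
have M_ge0 : 0 <= M.
  by apply: sumr_ge0 => i _; rewrite mulr_ge0 // (pd_ge0 (phiP i).2).
(* Nonnegativity makes the imaginary part vanish, and the Archimedean property is applied to the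
   real part. *)
have [N MN] : exists N : nat, M <= N%:R.
  move: M_ge0; rewrite lecE /= => /andP[/eqP ImM ReM].
  exists (Num.bound (complex.Re M)).
  rewrite -[_%:R](rmorph_nat (@real_complex R)) lecE /= ImM eqxx /=.
  exact/ltW/archi_boundP.
exists N => I s h b t s_gt0 sE h_orth.
apply: le_trans (_ : s ^+ 3 * M <= _); last by rewrite ler_pM2l ?exprn_gt0.
have -> : \sum_i \sum_j (-1) ^+ h i j * g (b i + t j) =
    \sum_k a k * \sum_i \sum_j (-1) ^+ h i j * phi k (b i + t j).
  apply/esym; under eq_bigr do rewrite mulr_sumr.
  rewrite exchange_big; apply: eq_bigr => i _ /=.
  under eq_bigr do rewrite mulr_sumr.
  rewrite exchange_big; apply: eq_bigr => j _ /=.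
  by rewrite gE mulr_sumr; apply: eq_bigr => k _; rewrite mulrCA.
apply: le_trans (ler_norm_sum _ _ _) _.
rewrite mulr_sumr; apply: ler_sum => k _.
rewrite normrM mulrCA ler_wpM2l //.
apply: (pd_orthogonal_bound (phiP k).2) => // i j.
exact: rmorph_sign.
Qed.
End FourierStieltjes.

(* Countably many dense open conditions on a two-valued function can be met
   simultaneously: Baire's theorem with finite partial functions. *)
Lemma generic_predicate (X : eqType) (Q : nat -> (X -> bool) -> Prop) :
  (forall m (E : seq X) (f : X -> bool), exists (E' : seq X) (f' : X -> bool),
    {in E, f' =1 f} /\ forall f'', {in E', f'' =1 f'} -> Q m f'') ->
  exists f, forall m, Q m f.
Proof.
move=> extend.
have /choice[step stepP] (mp : nat * (seq X * (X -> bool))) :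
    exists p : seq X * (X -> bool), [/\ {subset mp.2.1 <= p.1},
      {in mp.2.1, p.2 =1 mp.2.2} & forall f, {in p.1, f =1 p.2} -> Q mp.1 f].
  case: mp => m [E f]; have [E' [f' [ff' Qf']]] := extend m E f.
  exists (E ++ E', f'); split => //= [x xE|g gf']; first by rewrite mem_cat xE.
  by apply: Qf' => x xE'; apply: gf'; rewrite mem_cat xE' orbT.
pose p := fix p n := if n is m.+1 then step (m, p m) else ([::], xpredT).
have p_mono m n : (m <= n)%N ->
    {subset (p m).1 <= (p n).1} /\ {in (p m).1, (p n).2 =1 (p m).2}.
  elim: n => [|n IH]; first by rewrite leqn0 => /eqP ->.
  rewrite leq_eqVlt => /predU1P[->|]; first by split.
  rewrite ltnS => /IH[sub eqf].
  have [/= sub' eqf' _] := stepP (n, p n).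
  by split => x xp; [exact/sub'/sub | rewrite eqf' ?eqf// sub].
have /choice[f fP] (x : X) : exists v, forall m, x \in (p m).1 -> (p m).2 x = v.
  have [[m xm]|no] := pselect (exists m, x \in (p m).1); last first.
    by exists true => m xm; case: no; exists m.
  exists ((p m).2 x) => n xn.
  by have /orP[/p_mono[_ ->]|/p_mono[_ ->]] := leq_total m n.
by exists f => m; have [_ _] := stepP (m, p m); apply => x /(fP x m.+1).
Qed.

(** * Widely spaced points in sets that are not relatively compact *)

Section CompactSets.
Context {G : topologicalZmodType}.
Implicit Types A K : set G.

Lemma compact_add A K : compact A -> compact K ->
  compact [set a + k | a in A & k in K].
Proof.
move=> cA cK; have /continuous_compact := compact_setX cA cK.
move=> /(_ _ (fun x : G * G => x.1 + x.2)) H.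
have -> : [set a + k | a in A & k in K] = [set x.1 + x.2 | x in A `*` K].
  apply/seteqP; split=> x /=; first by move=> [a Aa [k Kk <-]]; exists (a, k).
  by move=> [[a k] [/= Aa Kk] <-]; exists a => //; exists k.
by apply: H; apply: continuous_subspaceT; exact: add_continuous.
Qed.

Lemma compact_opp K : compact K -> compact [set - k | k in K].
Proof.
apply: continuous_compact; apply: continuous_subspaceT.
exact: opp_continuous.
Qed.

(** Greedy choice: each new point avoids [P] and the translates of [K] and [- K] by the earlier
    points, whose union is compact. *)
Lemma spread_family (A K P : set G) (I : finType) :
  (forall K', compact K' -> exists2 x, A x & ~ K' x) ->
  compact K -> compact P ->
  exists x : I -> G, (forall i, A (x i) /\ ~ P (x i)) /\
    forall i j, i != j -> ~ K (x i - x j).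
Proof.
move=> A_big cK cP.
have [x [xP xK]] : exists x : nat -> G,
    (forall i, (i < #|I|)%N -> A (x i) /\ ~ P (x i)) /\
    forall i j, (i < #|I|)%N -> (j < i)%N -> ~ K (x i - x j) /\ ~ K (x j - x i).
  elim: #|I| => [|n [x [xP xK]]]; first by exists (fun=> 0).
  pose D := [set x i | i in `I_n].
  have cD : compact D by exact/finite_compact/finite_image/finite_II.
  have [y Ay] := A_big _ (compactU cP (compactU (compact_add cD cK)
    (compact_add cD (compact_opp cK)))).
  move=> /not_orP[Py /not_orP[DKy DNKy]].
  exists (fun i => if i == n then y else x i); split=> [i|i j].
    by rewrite ltnS leq_eqVlt; have [//|/= _] := eqVneq i n; exact: xP.
  rewrite ltnS leq_eqVlt => /predU1P[->|i_lt] ji; last first.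
    by rewrite !ltn_eqF ?(ltn_trans ji)//; exact: xK.
  rewrite eqxx ltn_eqF //; split=> Ky.
    apply: DKy; exists (x j); first by exists j.
    by exists (y - x j) => //; rewrite addrC subrK.
  apply: DNKy; exists (x j); first by exists j.
  exists (- (x j - y)); first by exists (x j - y).
  by rewrite opprB addrC subrK.
exists (x \o enum_rank); split=> [i|i j ij] /=; first exact: xP.
have [lt_ij|lt_ji|/val_inj/enum_rank_inj eq_ij] :=
  ltngtP (enum_rank i) (enum_rank j).
- by have [] := xK _ _ (ltn_ord _) lt_ij.
- by have [] := xK _ _ (ltn_ord _) lt_ji.
- by rewrite eq_ij eqxx in ij.
Qed.

(** The [b i] are chosen in [L], spread modulo [K - K]. Then the [t j] are chosen in the
    intersection for the finite set of all [b i], which places every [b i + t j] in [V + T]. *)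
Lemma spread_square (V K T L : set G) (E : seq G) (I : finType) :
  hausdorff_space G -> compact K -> V `<=` K -> ~ precompact L ->
  (forall F, F `<=` L -> finite_set F -> ~ precompact
    (\bigcap_(b in F) [set - b + s | s in [set u + t | u in V & t in T]])) ->
  exists (b t : I -> G) (s : I * I -> G), injective s /\
    forall ij, [/\ T (s ij), V (b ij.1 + t ij.2 - s ij) & s ij \notin E].
Proof.
move=> hG cK VK L_big fail.
have big A : ~ precompact A -> forall K', compact K' -> exists2 x, A x & ~ K' x.
  move=> A_big K' cK'; apply: contra_notP A_big => H.
  apply: precompact_subset (compact_precompact hG cK') => x Ax.
  by apply: contrapT => K'x; apply: H; exists x.
pose KK := [set x + y | x in K & y in [set - k | k in K]].
have cKK : compact KK by apply: compact_add => //; exact: compact_opp.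
have [b [bL bKK]] := spread_family I (big L L_big) cKK (@compact0 G).
pose D := [set b ij.2 - b ij.1 | ij in [set: I * I]].
pose D' := [set (p.2 - b p.1) | p in [set p : I * G | p.2 \in E]].
have cD : compact D by exact/finite_compact/finite_image.
have cD' : compact D'.
  apply/finite_compact/finite_image.
  apply: (@sub_finite_set _ _ ([set: I] `*` [set` E])) => [[i x] //|].
  exact: finite_setX.
have bD_big := fail [set b i | i in [set: I]] _ _.
have [||t [tA tD]] := spread_family I (big _ (bD_big _ _)) (compact_add cD cKK)
    (compact_add cD' cK).
- by move=> x /= [i _ <-]; have [] := bL i.
- exact/finite_image.
have /choice[s sP] (ij : I * I) : exists s, T s /\ V (b ij.1 + t ij.2 - s).
  have [/(_ (b ij.1) (imageT _ _))[_ [u Vu [s Ts <-]] tE] _] := tA ij.2.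
  by exists s; split => //; rewrite -tE addNKr addrK.
exists b, t, s; split.
  (* If the points of [T] coincide, then [b i + t j] and [b i' + t j'] differ by an element of
     [K - K]. The spread of the [t j] forces [j = j'], and that of the [b i] then forces
     [i = i']. *)
  move=> [i j] [i' j'] sE.
  have [_ Vu] := sP (i, j); have [_ Vu'] := sP (i', j').
  rewrite sE /= in Vu; rewrite /= in Vu'.
  have KKu : KK ((b i + t j - s (i', j')) - (b i' + t j' - s (i', j'))).
    exists (b i + t j - s (i', j')); first exact: VK.
    exists (- (b i' + t j' - s (i', j'))) => //.
    by exists (b i' + t j' - s (i', j')) => //; exact: VK.
  rewrite opprB addrA subrK in KKu.
  have [j_eq|jj'] := eqVneq j j'; last first.
    exfalso; apply: (tD _ _ jj'); exists (b i' - b i); first by exists (i, i').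
    exists (b i + t j - (b i' + t j')) => //.
    by rewrite addrA subrKA [b i' + t j]addrC addrKA.
  have [->|ii'] := eqVneq i i'; first by rewrite j_eq.
  by exfalso; apply: (bKK _ _ ii'); rewrite -j_eq [b i' + _]addrC addrKA in KKu.
move=> [i j]; have [Ts Vu] := sP (i, j); split => //.
(* A point of [E] here would put [t j] into [D' + K], which the choice of the [t j] excludes. *)
apply/negP => sE; have [_] := tA j; apply.
exists (s (i, j) - b i); first by exists (i, s (i, j)).
exists (b i + t j - s (i, j)); first exact: VK.
by rewrite addrA subrKA [s (i, j) + _]addrC addrK.
Qed.

End CompactSets.

(** * Consequences of interpolation along a countable base at 0 *)

Section Interpolation.
Context {R : realType} {G : topologicalZmodType}.
Implicit Types T K S : set G.

Lemma interpolation_sign T (f : G -> bool) : BG_interpolation R T ->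
  exists2 g : G -> R[i]^o, fourier_stieltjes g &
    forall t, T t -> g t = (-1) ^+ f t.
Proof.
apply; exists 1; split => // M /ltW M1 t _ /=.
by rewrite normr_sign.
Qed.

Section CountableBase.
Variables (T : set G) (U : nat -> set G).
Hypothesis G_hausdorff : hausdorff_space G.
Hypothesis T_interp : BG_interpolation R T.
Hypothesis U_nbhs : forall n, nbhs (0 : G) (U n).
Hypothesis U_base : forall V, nbhs (0 : G) V ->
  exists n, forall m, (n <= m)%N -> U m `<=` V.

(** A generic sign function separates a [U m]-close pair in [T] for every [m]; its extension would
    jump by 2 over arbitrarily small differences. *)
Lemma interpolation_separated :
  exists n, forall s s', T s -> T s' -> U n (s - s') -> s = s'.
Proof.
apply: contrapT => no_sep.
have bad n : exists s s', [/\ T s, T s', U n (s - s') & s != s'].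
  apply: contrapT => good; apply: no_sep; exists n => s s' Ts Ts' Uss'.
  by apply/eqP/negPn/negP => ss'; apply: good; exists s, s'.
have [m E f|f fP] := @generic_predicate G (fun m f => exists s s',
    [/\ T s, T s', U m (s - s') & f s != f s']).
  (* Avoiding the finitely many nonzero differences within [E] ensures that [s] and [s'] are not
     both in [E], so the sign of one of them is still free. *)
  pose D := [set x - y | x in [set` E] & y in [set` E]] `\ 0.
  have D_nbhs : nbhs (0 : G) (~` D).
    apply: open_nbhs_nbhs; split; last by case=> _; apply.
    apply: closed_openC; apply: (iffLR accessible_finite_set_closed).
      exact: hausdorff_accessible.
    by apply: finite_setD; exact: finite_image2.
  have [n Un] := U_base (filterI (U_nbhs m) D_nbhs).
  have [s [s' [Ts Ts' Uss' ss']]] := bad n.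
  have [Umss' Dss'] := Un _ (leqnn n) _ Uss'.
  have [sE|sE] := boolP (s \in E); last first.
    exists [:: s; s'], (fun x => if x == s then ~~ f s' else f x); split.
      by move=> x xE; case: eqP => // xs; rewrite -xs xE in sE.
    move=> g gE; exists s, s'; split=> //.
    rewrite !gE ?inE ?eqxx ?orbT // [s' == s]eq_sym (negbTE ss').
    by case: (f s').
  have s'E : s' \notin E.
    apply/negP => s'E; apply: Dss'; split; first by exists s => //; exists s'.
    by move/eqP; rewrite subr_eq0 (negbTE ss').
  exists [:: s; s'], (fun x => if x == s' then ~~ f s else f x); split.
    by move=> x xE; case: eqP => // xs; rewrite -xs xE in s'E.
  move=> g gE; exists s, s'; split=> //.
  rewrite !gE ?inE ?eqxx ?orbT // (negbTE ss').
  by case: (f s).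
have [g g_fs gE] := interpolation_sign f T_interp.
have [n Un] := U_base (fourier_stieltjes_unif g_fs (@ltr01 R[i])).
have [s [s' [Ts Ts' Uss' ss']]] := fP n.
have := Un _ (leqnn n) _ Uss' _ _ erefl.
rewrite !gE //.
have -> : (-1) ^+ f s - (-1) ^+ f s' = (-1) ^+ f s * 2 :> R[i].
  case: (f s) (f s') ss' => -[] // _; rewrite ?expr0 ?expr1; ring.
by rewrite normrMsign normr_nat (ler_nat _ 2 1).
Qed.

Lemma interpolation_translation_compact K :
  compact K -> (forall n, U n `<=` K) ->
  exists n, right_translation_compact [set u + t | u in U n & t in T].
Proof.
move=> cK UK; apply: contrapT => no_tc.
have bad n : exists2 L, ~ precompact L & forall F, F `<=` L -> finite_set F ->
    ~ precompact (\bigcap_(b in F)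
        [set - b + s | s in [set u + t | u in U n & t in T]]).
  apply: contrapT => good; apply: no_tc; exists n => L L_big.
  apply: contrapT => noF; apply: good; exists L => // F FL finF pF.
  by apply: noF; exists F.
(* The even exponent makes the square root of the matrix order [2 ^ (m * 2)] equal to [2 ^ m]. *)
pose I m := {ffun 'I_(m * 2) -> bool}.
have [m E f|f fP] := @generic_predicate G (fun m f =>
    exists (b t : I m -> G) (s : I m * I m -> G), forall ij,
    [/\ T (s ij), U m (b ij.1 + t ij.2 - s ij) & f (s ij) = walsh ij.1 ij.2]).
  have [L L_big L_fail] := bad m.
  have [b [t [s [s_inj sP]]]] :=
    spread_square E (I m) G_hausdorff cK (UK m) L_big L_fail.
  (* The new signs are well defined because [s] is injective, and respect the old ones because its
     values lie outside [E]. *)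
  exists (codom s), (fun x =>
    if [pick ij | s ij == x] is Some ij then walsh ij.1 ij.2 else f x); split.
    move=> x xE; case: pickP => // ij /eqP sx; have [_ _] := sP ij.
    by rewrite sx xE.
  move=> g gE; exists b, t, s => ij; have [Ts Us _] := sP ij; split => //.
  rewrite gE ?codom_f //; case: pickP => [kl /eqP/s_inj -> //|/(_ ij)].
  by rewrite eqxx.
have [g g_fs gE] := interpolation_sign f T_interp.
have [M gM] := fourier_stieltjes_orthogonal_bound g_fs.
have half_gt0 : 0 < 2^-1 :> R[i] by rewrite invr_gt0.
have [n Un] := U_base (fourier_stieltjes_unif g_fs half_gt0).
(* The bound by [n] makes [g] vary by at most 1/2 over [U m]; the bound by [2 * M] gives
   [2 * M < 2 ^ m]. *)
pose m := maxn n (2 * M).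
have [b [t [s sP]]] := fP m.
pose r : R[i] := 2 ^+ m.
have r_gt0 : 0 < r by rewrite exprn_gt0.
have rE : r ^+ 2 = #|I m|%:R.
  by rewrite card_ffun card_bool card_ord natrX exprM.
have h_orth j k : \sum_(i : I m) (-1) ^+ walsh i j * (-1) ^+ walsh i k
    = (j == k)%:R * r ^+ 2 :> R[i].
  by rewrite walsh_orthogonal exprM.
have := gM _ _ _ b t r_gt0 rE h_orth.
set S := \sum_i _ => S_le.
(* Each of the [r ^+ 4] terms of [S] is within 1/2 of 1, since [g] at the nearby point of [T] is the
   matching sign. *)
have S_near : `|r ^+ 4 - S| <= r ^+ 4 / 2.
  have r4E : r ^+ 4 = \sum_(i : I m) \sum_(j : I m) (1 : R[i]).
    rewrite !sumr_const cardT -cardE -[RHS]mulr_natr -rE; ring.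
  rewrite r4E -sumrB mulr_suml.
  apply: le_trans (ler_norm_sum _ _ _) _; apply: ler_sum => i _.
  rewrite -sumrB mulr_suml.
  apply: le_trans (ler_norm_sum _ _ _) _; apply: ler_sum => j _.
  have [Ts Us fs] := sP (i, j).
  have := Un _ (leq_maxl _ _) _ Us _ _ erefl.
  rewrite (gE _ Ts) fs mul1r /=; apply: le_trans.
  rewrite -(normrMsign (walsh i j)) mulrBr mulrA -expr2 sqrr_sign.
  by rewrite mulr1 mul1r distrC.
have : r ^+ 4 / 2 <= `|S|.
  rewrite -(lerD2l (r ^+ 4 / 2)) -splitr -[X in X <= _]gtr0_norm ?exprn_gt0 //.
  rewrite -[X in `|X|](subrK S).
  by apply: le_trans (ler_normD _ _) _; rewrite lerD2r.
move=> /le_trans /(_ S_le).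
have -> : r ^+ 4 / 2 = r ^+ 3 * (r / 2) by field.
rewrite ler_pM2l ?exprn_gt0 // ler_pdivrMr // -natrM /r -natrX ler_nat.
apply/negP; rewrite -ltnNge mulnC.
exact: leq_ltn_trans (leq_maxr _ _) (ltn_expl _ _).
Qed.

End CountableBase.
End Interpolation.

(** * Separation and countable bases in metrizable spaces *)

Section Metrizable.
Context {R : realType} {X : topologicalType}.

Lemma metrizable_hausdorff : metrizable R X -> hausdorff_space X.
Proof.
move=> [d [d0 dC dD dnbhs]] p q clpq; apply/d0/eqP/negPn/negP => dpq_neq0.
have dpq_gt0 : 0 < d p q.
  (* Nonnegativity of [d] comes from the triangle inequality: [d p p = 0] is at most
     [d p q + d q p]. *)
  rewrite lt_def dpq_neq0 /= -(@pmulrn_lge0 _ _ 2%N) // mulr2n {2}dC.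
  by apply: le_trans (dD p q p); have /d0 -> : p = p.
have ball_nbhs x : nbhs x [set z | d x z < d p q / 2].
  by rewrite dnbhs; exists (d p q / 2) => //=; rewrite divr_gt0.
have [z [/= pz qz]] := clpq _ _ (ball_nbhs p) (ball_nbhs q).
have := dD p z q; rewrite (dC z) leNgt => /negP; apply.
by rewrite [ltRHS]splitr ltrD.
Qed.

Lemma metrizable_nbhs_base (x : X) : metrizable R X ->
  exists U : nat -> set X, (forall n, nbhs x (U n)) /\
    forall V, nbhs x V -> exists n, forall m, (n <= m)%N -> U m `<=` V.
Proof.
move=> [d [_ _ _ ->]].
exists (fun n => [set z | d x z < n.+1%:R^-1]); split=> [n|V [e /= e_gt0 eV]].
  by exists n.+1%:R^-1 => //=.
exists (Num.bound e^-1) => m em z /= dz; apply: eV; apply: (lt_le_trans dz).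
rewrite -[leRHS]invrK lef_pV2 ?posrE ?invr_gt0 //.
apply: le_trans (ltW (archi_boundP _)) _; first by rewrite invr_ge0 ltW.
by rewrite ler_nat leqW.
Qed.

End Metrizable.

(** * Metric and compactness in discrete spaces *)

Section DiscreteSpace.
Context {X : topologicalType}.
Hypothesis X_discrete : discrete_top X.

Lemma discrete_top_nbhs (x : X) (A : set X) : nbhs x A = A x.
Proof. by rewrite X_discrete propeqE; exact: principal_filterP. Qed.

Lemma discrete_top_open (A : set X) : open A.
Proof. by rewrite openE => x Ax; rewrite /interior discrete_top_nbhs. Qed.

Lemma discrete_top_metrizable (R : realType) : metrizable R X.
Proof.
exists (fun x y => (x != y)%:R); split.
- move=> x y; split=> [/eqP|->]; last by rewrite eqxx.
  by rewrite pnatr_eq0 eqb0 negbK => /eqP.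
- by move=> x y; rewrite eq_sym.
- move=> x y z; rewrite -natrD ler_nat.
  have [->|_] := eqVneq x y; first by rewrite add0n.
  exact: leq_trans (leq_b1 _) (leq_addr _ _).
- move=> x; apply/seteqP; split=> A; rewrite discrete_top_nbhs /=.
    move=> Ax; exists 1 => //= z /=.
    by have [<- _|_] := eqVneq x z; [exact: Ax | rewrite ltxx].
  by move=> [e /= e_gt0 eA]; apply: (eA x) => /=; rewrite eqxx.
Qed.

(** On an infinite [K] the filter of sets containing all but finitely many points of [K] is proper,
    but it has no cluster point. *)
Lemma discrete_top_precompact (A : set X) : precompact A -> finite_set A.
Proof.
move=> [K AK [cK _]]; apply: (sub_finite_set AK).
apply: contrapT => K_inf.
pose F : set_system X := [set B | finite_set (K `\` B)].
have FF : ProperFilter F.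
  split; first by rewrite /F /= setD0.
  split; rewrite /F /=.
  - by rewrite /= setDT; exact: finite_set0.
  - by move=> B C KB KC; rewrite /= setDIr finite_setU.
  - by move=> B C BC; apply: sub_finite_set => x [Kx nCx]; split=> // /BC.
have FK : F K by rewrite /F /= setDv; exact: finite_set0.
have [x [Kx clx]] := cK F FF FK.
have Fx : F (~` [set x]).
  by apply: (sub_finite_set _ (finite_set1 x)) => y [_ /contrapT].
have x1 : nbhs x [set x] by rewrite discrete_top_nbhs.
by have [y [nyx]] := clx _ _ Fx x1.
Qed.

Lemma discrete_top_locally_compact : locally_compact [set: X].
Proof.
move=> x _; exists [set x]; last split.
- have x1 : nbhs x [set x] by rewrite discrete_top_nbhs.
  by apply: filterS x1.
- exact: compact_set1.
- by rewrite -[[set x]]setCK; exact/open_closedC/discrete_top_open.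
Qed.
End DiscreteSpace.

(** * Left and right translates agree by commutativity *)

Section Translates.
Context {G : topologicalZmodType}.
Implicit Types S : set G.

Lemma translates_addC S (b : G) : [set s - b | s in S] = [set - b + s | s in S].
Proof. by apply: eq_imagel => s _; rewrite addrC. Qed.

Lemma right_translation_compact_subset S S' :
  S `<=` S' -> right_translation_compact S' -> right_translation_compact S.
Proof.
move=> SS' tcS' L /tcS'[F [FL finF pF]]; exists F; split=> //.
apply: precompact_subset pF; apply: subset_bigcap => b _.
exact: image_subset.
Qed.

Lemma translation_compactP S :
  translation_compact S <-> right_translation_compact S.
Proof.
split=> [[]//|tcS]; split=> // L /tcS[F [FL finF pF]]; exists F; split=> //.
by under eq_bigcapr do rewrite translates_addC.
Qed.

Lemma translation_finiteP S :
  translation_finite S <-> right_translation_finite S.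
Proof.
split=> [[]//|tfS]; split=> // L /tfS[F [FL finF pF]]; exists F; split=> //.
by under eq_bigcapr do rewrite translates_addC.
Qed.

Lemma nbhs0_sub (W : set G) : nbhs (0 : G) W ->
  exists2 V : set G, nbhs 0 V & forall x y, V x -> V y -> W (x - y).
Proof.
move=> W0; have := @sub_continuous G (0, 0) W; rewrite /= subr0.
move=> /(_ W0)[[A B] /= [A0 B0] AB]; exists (A `&` B); first exact: filterI.
by move=> x y [Ax _] [_ By]; exact: (AB (x, y)).
Qed.
End Translates.

Theorem corollary4p14 (R : realType) :
  (forall G : topologicalZmodType,
     metrizable R G -> locally_compact [set: G] ->
     forall T : set G, BG_interpolation R T ->
       exists2 U : set G, nbhs 0 U &
         right_uniformly_discrete U T /\
         translation_compact [set u + t | u in U & t in T])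
  /\
  (forall G : topologicalZmodType,
     discrete_top G ->
     forall T : set G, BG_interpolation R T -> translation_finite T).
Proof.
suff metrizable_case : forall G : topologicalZmodType,
     metrizable R G -> locally_compact [set: G] ->
     forall T : set G, BG_interpolation R T ->
       exists2 U : set G, nbhs 0 U &
         right_uniformly_discrete U T /\
         translation_compact [set u + t | u in U & t in T].
  split=> // G G_discr T T_interp.
  have [U U0 [_ /translation_compactP tcUT]] := metrizable_case G
    (discrete_top_metrizable G_discr R) (discrete_top_locally_compact G_discr)
    T T_interp.
  apply/translation_finiteP => L L_inf.
  have [|F [FL finF pF]] := tcUT L.
    by move/(discrete_top_precompact G_discr).
  exists F; split=> //; apply: discrete_top_precompact => //.
  apply: precompact_subset pF; apply: subset_bigcap => b _.
  (* Since 0 lies in [U], the set [T] is contained in [U + T]. *)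
  apply: image_subset => t Tt; exists 0; first exact: nbhs_singleton.
  by exists t => //; rewrite add0r.
move=> G G_metr G_lc T T_interp.
have G_hausdorff := metrizable_hausdorff G_metr.
have [B [B_nbhs B_base]] := metrizable_nbhs_base 0 G_metr.
have [K K0 [cK _]] := G_lc 0 I.
have {}K0 : nbhs (0 : G) K.
  by move: K0; rewrite /within /=; apply: filterS => x; apply.
have [n sep] := interpolation_separated G_hausdorff T_interp B_nbhs B_base.
have [V V0 VB] := nbhs0_sub (B_nbhs n).
(* Cutting the base down to [K] keeps it a base and bounds all its members by one compact set. *)
have [W|k x []//|m tc] := interpolation_translation_compact
  (U := fun n => B n `&` K) G_hausdorff T_interp _ cK _.
  by move=> /B_base[i iW]; exists i => j /iW jW x [/jW].
exists (V `&` (B m `&` K)); first by apply: filterI => //; exact: filterI.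
split; last first.
  apply/translation_compactP; apply: right_translation_compact_subset tc.
  by move=> _ [u [_ Uu] [t Tt <-]]; exists u => //; exists t.
move=> s s' Ts Ts' ss'; apply/seteqP; split=> // x.
move=> [[u [Vu _] <-] [u' [Vu' _] uu']].
apply: ss'; apply: sep => //.
(* A common point [u + s = u' + s'] puts [s - s'] into [V - V], hence into [B n], where [sep]
   applies. *)
have -> : s - s' = u' - u.
  by apply/eqP; rewrite subr_eq addrAC eq_sym subr_eq uu' addrC.
exact: VB.
Qed.
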